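(* Let $c=\tfrac{2\sqrt2}{3}$ (the tetrahedron case). Among all $G^1$-admissible quartic patches $\boldsymbol{p}$ (in the sense of the context, with real parameters $\alpha,\beta,\gamma,\zeta,\xi$), the simplified radial error $d_s(\boldsymbol{p})$ attains its minimum at the patch with $$\gamma=\frac{2189+108\sqrt{2291}}{7602},$$ and the radial error $d_r(\boldsymbol{p})$ attains its minimum at the patch with $$\gamma=\frac{9587-2916\sqrt3}{4686},$$ where in both cases the other parameters are given by $$\alpha=\frac{(6c^2-4)\gamma+c^2+2}{4c^2},\quad \beta=\frac{2\gamma-1}{2c^2},\quad \zeta=\frac{-4(9c^4-18c^2+8)\gamma+9c^6-24c^4-4c^2+16}{12c^2(3c^4-7c^2+4)},\quad \xi=\frac{-2(3c^4-3c^2-2)\gamma-c^2-2}{12c^2(1-c^2)}.$$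
   Context: $\Delta=\{(u,v)\in\mathbb{R}^2:\ 0\le u,v\le 1,\ v\le 1-u\}$ and $\|\cdot\|$ is the Euclidean norm. Let $\boldsymbol{v}_0=(c,0,\sqrt{1-c^2})^T$, $\boldsymbol{v}_1=(-\tfrac12c,\tfrac{\sqrt3}{2}c,\sqrt{1-c^2})^T$, $\boldsymbol{v}_2=(-\tfrac12c,-\tfrac{\sqrt3}{2}c,\sqrt{1-c^2})^T$ be the vertices of an equilateral spherical triangle on the unit sphere. The quartic patch is $\boldsymbol{p}:\Delta\to\mathbb{R}^3$, $\boldsymbol{p}(u,v)=\sum_{i+j+k=4}\frac{4!}{i!j!k!}u^iv^j(1-u-v)^k\,\boldsymbol{b}_{i,j,k}$ (with $i,j,k$ nonnegative integers), where $\boldsymbol{b}_{4,0,0}=\boldsymbol{v}_0$, $\boldsymbol{b}_{0,4,0}=\boldsymbol{v}_1$, $\boldsymbol{b}_{0,0,4}=\boldsymbol{v}_2$, $\boldsymbol{b}_{3,1,0}=\alpha\boldsymbol{v}_0+\beta\boldsymbol{v}_1$, $\boldsymbol{b}_{2,2,0}=\gamma(\boldsymbol{v}_0+\boldsymbol{v}_1)$, $\boldsymbol{b}_{2,1,1}=\zeta\boldsymbol{v}_0+\xi(\boldsymbol{v}_1+\boldsymbol{v}_2)$, and the remaining control points are obtained from these by symmetry, i.e. by applying the same permutation to the three index positions and to $(\boldsymbol{v}_0,\boldsymbol{v}_1,\boldsymbol{v}_2)$ (for instance $\boldsymbol{b}_{1,3,0}=\alpha\boldsymbol{v}_1+\beta\boldsymbol{v}_0$,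 $\boldsymbol{b}_{0,2,2}=\gamma(\boldsymbol{v}_1+\boldsymbol{v}_2)$, $\boldsymbol{b}_{1,2,1}=\zeta\boldsymbol{v}_1+\xi(\boldsymbol{v}_0+\boldsymbol{v}_2)$). The patch is called $G^1$-admissible if: (1) it is regular: $\partial_u\boldsymbol{p}$ and $\partial_v\boldsymbol{p}$ are linearly independent at every point of $\Delta$; (2) at each of the three vertices $\boldsymbol{v}_m$ of the patch, the normal of the tangent plane of the patch is parallel to $\boldsymbol{v}_m$; (3) at every point of each of the three boundary curves of the patch, the normal $\partial_u\boldsymbol{p}\times\partial_v\boldsymbol{p}$ lies in the plane through the origin and the two endpoints of that boundary curve. Errors: $d_s(\boldsymbol{p})=\max_{(u,v)\in\Delta}\big|\|\boldsymbol{p}(u,v)\|^2-1\big|$ and $d_r(\boldsymbol{p})=\max_{(u,v)\in\Delta}\big|\|\boldsymbol{p}(u,v)\|-1\big|$. *)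

(* Defs.v *)
From Stdlib Require Import Reals Lra Lia Factorial ClassicalEpsilon.
From Coquelicot Require Import Coquelicot.
Open Scope R_scope.

(* Coquelicot's product norm on [R * R * R] is the Euclidean norm,
   see [norm_euclidean] below. *)
Definition vec : Type := (R * R * R)%type.

Definition mkvec (x y z : R) : vec := (x, y, z).
Definition xc (a : vec) : R := fst (fst a).
Definition yc (a : vec) : R := snd (fst a).
Definition zc (a : vec) : R := snd a.

Definition vadd (a b : vec) : vec := plus (a : R * R * R) b.
Definition smul (t : R) (a : vec) : vec := scal t (a : R * R * R).
Definition vzero : vec := zero : R * R * R.
Definition vnorm (a : vec) : R := norm (a : R * R * R).

Definition cross (a b : vec) : vec :=
  mkvec (yc a * zc b - zc a * yc b) (zc a * xc b - xc a * zc b)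
        (xc a * yc b - yc a * xc b).

Definition lin_indep (a b : vec) : Prop :=
  forall s t : R, vadd (smul s a) (smul t b) = vzero -> s = 0 /\ t = 0.

Definition parallel (n a : vec) : Prop := exists t : R, n = smul t a.

Definition in_plane (a b n : vec) : Prop :=
  exists s t : R, n = vadd (smul s a) (smul t b).

Definition Delta (u v : R) : Prop := 0 <= u <= 1 /\ 0 <= v <= 1 /\ v <= 1 - u.

Definition v0 (c : R) : vec := mkvec c 0 (sqrt (1 - c ^ 2)).
Definition v1 (c : R) : vec :=
  mkvec (- (1 / 2) * c) (sqrt 3 / 2 * c) (sqrt (1 - c ^ 2)).
Definition v2 (c : R) : vec :=
  mkvec (- (1 / 2) * c) (- (sqrt 3 / 2) * c) (sqrt (1 - c ^ 2)).

(* Meaningful for [i + j + k = 4]; the fallback value is never used by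
   [patch]. *)
Definition control (c alpha beta gamma zeta xi : R) (i j k : nat) : vec :=
  match i, j, k with
  | 4, 0, 0 => v0 c
  | 0, 4, 0 => v1 c
  | 0, 0, 4 => v2 c
  | 3, 1, 0 => vadd (smul alpha (v0 c)) (smul beta (v1 c))
  | 3, 0, 1 => vadd (smul alpha (v0 c)) (smul beta (v2 c))
  | 1, 3, 0 => vadd (smul alpha (v1 c)) (smul beta (v0 c))
  | 0, 3, 1 => vadd (smul alpha (v1 c)) (smul beta (v2 c))
  | 1, 0, 3 => vadd (smul alpha (v2 c)) (smul beta (v0 c))
  | 0, 1, 3 => vadd (smul alpha (v2 c)) (smul beta (v1 c))
  | 2, 2, 0 => smul gamma (vadd (v0 c) (v1 c))
  | 2, 0, 2 => smul gamma (vadd (v0 c) (v2 c))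
  | 0, 2, 2 => smul gamma (vadd (v1 c) (v2 c))
  | 2, 1, 1 => vadd (smul zeta (v0 c)) (smul xi (vadd (v1 c) (v2 c)))
  | 1, 2, 1 => vadd (smul zeta (v1 c)) (smul xi (vadd (v0 c) (v2 c)))
  | 1, 1, 2 => vadd (smul zeta (v2 c)) (smul xi (vadd (v0 c) (v1 c)))
  | _, _, _ => vzero
  end%nat.

Definition bernstein4 (i j k : nat) (u v : R) : R :=
  INR (fact 4) / INR (fact i * fact j * fact k)
  * (u ^ i * v ^ j * (1 - u - v) ^ k).

(* The polynomial is defined on the whole plane, so that its partial
   derivatives at boundary points of the triangle are ordinary two-sided ones. *)
Definition patch (c alpha beta gamma zeta xi : R) (u v : R) : vec :=
  sum_n (fun i : nat =>
    sum_n (fun j : nat =>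
      let k := (4 - i - j)%nat in
      smul (bernstein4 i j k u v)
           (control c alpha beta gamma zeta xi i j k)
        : R * R * R)
      (4 - i)%nat) 4%nat.

Definition Derive_vec (f : R -> vec) (t : R) : vec :=
  mkvec (Derive (fun s => xc (f s)) t) (Derive (fun s => yc (f s)) t)
        (Derive (fun s => zc (f s)) t).

Definition d_u (p : R -> R -> vec) (u v : R) : vec :=
  Derive_vec (fun s => p s v) u.
Definition d_v (p : R -> R -> vec) (u v : R) : vec :=
  Derive_vec (fun s => p u s) v.

Definition normal (p : R -> R -> vec) (u v : R) : vec :=
  cross (d_u p u v) (d_v p u v).

Definition regular (p : R -> R -> vec) : Prop :=
  forall u v : R, Delta u v -> lin_indep (d_u p u v) (d_v p u v).

(* The parameters (1, 0), (0, 1), (0, 0) are those of the vertices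
   [v0 c], [v1 c], [v2 c]. *)
Definition vertex_normals (c : R) (p : R -> R -> vec) : Prop :=
  parallel (normal p 1 0) (v0 c) /\
  parallel (normal p 0 1) (v1 c) /\
  parallel (normal p 0 0) (v2 c).

Definition boundary_normals (c : R) (p : R -> R -> vec) : Prop :=
  forall t : R, 0 <= t <= 1 ->
    in_plane (v0 c) (v1 c) (normal p t (1 - t)) /\
    in_plane (v1 c) (v2 c) (normal p 0 t) /\
    in_plane (v0 c) (v2 c) (normal p t 0).

Definition G1_admissible (c : R) (p : R -> R -> vec) : Prop :=
  regular p /\ vertex_normals c p /\ boundary_normals c p.

(* For continuous [f] this supremum is a maximum: [max_Delta_is_max]. *)
Definition max_Delta (f : R -> R -> R) : R :=
  real (Lub_Rbar (fun e => exists u v : R, Delta u v /\ e = f u v)).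

Definition d_s (p : R -> R -> vec) : R :=
  max_Delta (fun u v => Rabs (vnorm (p u v) ^ 2 - 1)).

Definition d_r (p : R -> R -> vec) : R :=
  max_Delta (fun u v => Rabs (vnorm (p u v) - 1)).

Definition alpha_of (c gamma : R) : R :=
  ((6 * c ^ 2 - 4) * gamma + c ^ 2 + 2) / (4 * c ^ 2).
Definition beta_of (c gamma : R) : R := (2 * gamma - 1) / (2 * c ^ 2).
Definition zeta_of (c gamma : R) : R :=
  (- 4 * (9 * c ^ 4 - 18 * c ^ 2 + 8) * gamma
     + 9 * c ^ 6 - 24 * c ^ 4 - 4 * c ^ 2 + 16)
  / (12 * c ^ 2 * (3 * c ^ 4 - 7 * c ^ 2 + 4)).
Definition xi_of (c gamma : R) : R :=
  (- 2 * (3 * c ^ 4 - 3 * c ^ 2 - 2) * gamma - c ^ 2 - 2)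
  / (12 * c ^ 2 * (1 - c ^ 2)).

Definition family_patch (c gamma : R) : R -> R -> vec :=
  patch c (alpha_of c gamma) (beta_of c gamma) gamma
        (zeta_of c gamma) (xi_of c gamma).

Lemma norm_euclidean (x y z : R) :
  vnorm (mkvec x y z) = sqrt (x ^ 2 + y ^ 2 + z ^ 2).
Proof.
  change (sqrt (sqrt (Rabs x ^ 2 + Rabs y ^ 2) ^ 2 + Rabs z ^ 2)
          = sqrt (x ^ 2 + y ^ 2 + z ^ 2)).
  rewrite !pow2_abs, pow2_sqrt by nra. reflexivity.
Qed.

Lemma max_Delta_is_max (f : R -> R -> R)
  (hf : forall u v, continuity_2d_pt f u v) :
  (exists u v, Delta u v /\ max_Delta f = f u v) /\
  (forall u v, Delta u v -> f u v <= max_Delta f).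
Proof.
  set (F := fun s t => f s (t * (1 - s))).
  assert (hF : forall s t, continuity_2d_pt F s t).
  { intros s t. apply continuity_2d_pt_filterlim.
    apply (continuous_comp_2 (fun z : R * R => fst z)
             (fun z : R * R => snd z * (1 - fst z)) f (s, t)).
    - apply (continuous_fst (U := R_UniformSpace) (V := R_UniformSpace)).
    - apply (continuous_mult (fun z : R * R => snd z)
               (fun z : R * R => 1 - fst z) (s, t)).
      + apply continuous_snd.
      + apply (continuous_minus (fun _ : R * R => 1) (fun z => fst z)).
        * apply continuous_const.
        * apply continuous_fst.
    - apply (proj1 (continuity_2d_pt_filterlim f s (t * (1 - s)))), hf. }
  assert (hFt : forall s t, continuity_pt (F s) t).
  { intros s t. apply continuity_pt_locally. intros eps.
    destruct (hF s t eps) as [d hd]. exists d. intros y hy. apply hd.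
    - unfold Rminus. rewrite Rplus_opp_r, Rabs_R0. apply cond_pos.
    - exact hy. }
  assert (hmax : forall s, {t | (forall t', 0 <= t' <= 1 -> F s t' <= F s t)
                               /\ 0 <= t <= 1}).
  { intros s. apply ClassicalEpsilon.constructive_indefinite_description.
    apply continuity_ab_maj; [lra | intros; apply hFt]. }
  set (tm := fun s => proj1_sig (hmax s)).
  set (g := fun s => F s (tm s)).
  assert (hg : forall s t, 0 <= t <= 1 -> F s t <= g s).
  { intros s t ht. exact (proj1 (proj2_sig (hmax s)) t ht). }
  assert (htm : forall s, 0 <= tm s <= 1).
  { intros s. exact (proj2 (proj2_sig (hmax s))). }
  assert (hgc : forall s, continuity_pt g s).
  { intros s. apply continuity_pt_locally. intros eps.
    destruct (uniform_continuity_2d F (s - 1) (s + 1) 0 1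
                (fun x y _ _ => hF x y) eps) as [d hd].
    assert (hm : 0 < Rmin d 1) by (apply Rmin_pos; [apply cond_pos | lra]).
    exists (mkposreal _ hm). intros y hy.
    change (Rabs (y - s) < Rmin d 1) in hy.
    assert (h1 : Rabs (y - s) < d) by (eapply Rlt_le_trans; [exact hy | apply Rmin_l]).
    assert (h2 : Rabs (y - s) < 1) by (eapply Rlt_le_trans; [exact hy | apply Rmin_r]).
    apply Rabs_def2 in h2.
    assert (hz : forall z : R, Rabs (z - z) < d).
    { intros z. unfold Rminus. rewrite Rplus_opp_r, Rabs_R0. apply cond_pos. }
    assert (e1 := hd s (tm y) y (tm y) ltac:(lra) (htm y) ltac:(lra) (htm y) h1 (hz _)).
    assert (e2 := hd s (tm s) y (tm s) ltac:(lra) (htm s) ltac:(lra) (htm s) h1 (hz _)).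
    apply Rabs_def2 in e1. apply Rabs_def2 in e2.
    assert (g1 := hg s (tm y) (htm y)). assert (g2 := hg y (tm s) (htm s)).
    unfold g in *. apply Rabs_def1; lra. }
  destruct (continuity_ab_maj g 0 1 ltac:(lra) (fun s _ => hgc s))
    as [s0 [hs0 hs0']].
  assert (hD0 : Delta s0 (tm s0 * (1 - s0))).
  { assert (h := htm s0). unfold Delta. repeat split; nra. }
  assert (hub : forall u v, Delta u v -> f u v <= g s0).
  { intros u v [hu [hv huv]].
    assert (ht : exists t, 0 <= t <= 1 /\ v = t * (1 - u)).
    { destruct (Req_dec u 1) as [e | ne].
      - exists 0. split; [lra | subst u; lra].
      - exists (v / (1 - u)). split; [| field; lra].
        split.
        + apply Rdiv_le_0_compat; lra.
        + apply (Rmult_le_reg_r (1 - u)); [lra |].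
          unfold Rdiv. rewrite Rmult_assoc, Rinv_l by lra. lra. }
    destruct ht as [t [ht ->]].
    apply Rle_trans with (g u); [exact (hg u t ht) | apply hs0; lra]. }
  assert (hE : max_Delta f = g s0).
  { unfold max_Delta.
    rewrite (is_lub_Rbar_unique _ (Finite (g s0))); [reflexivity |].
    split.
    - intros e [u [v [h ->]]]. apply hub, h.
    - intros b hb. apply hb. exists s0, (tm s0 * (1 - s0)). split; [exact hD0 | reflexivity]. }
  rewrite hE. split.
  - exists s0, (tm s0 * (1 - s0)). split; [exact hD0 | reflexivity].
  - exact hub.
Qed.

Lemma vnorm_patch_continuous (c alpha beta gamma zeta xi u v : R) :
  continuity_2d_pt
    (fun u v => vnorm (patch c alpha beta gamma zeta xi u v)) u v.
Proof.
  apply continuity_2d_pt_filterlim.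
  set (q := fun z : R * R => patch c alpha beta gamma zeta xi (fst z) (snd z) : R * R * R).
  assert (hsum : forall (h : nat -> R * R -> R * R * R) n,
            (forall i, continuous (h i) (u, v)) ->
            continuous (fun z => sum_n (fun i => h i z) n) (u, v)).
  { intros h n hh. induction n as [| n IH].
    - apply continuous_ext with (h 0%nat).
      + intros z. now rewrite sum_O.
      + apply hh.
    - apply continuous_ext with
        (fun z => plus (sum_n (fun i => h i z) n) (h (S n) z)).
      + intros z. now rewrite sum_Sn.
      + now apply (continuous_plus (fun z => sum_n (fun i => h i z) n) (h (S n))). }
  assert (hpow : forall (h : R * R -> R) n, continuous h (u, v) ->
            continuous (fun z => h z ^ n) (u, v)).
  { intros h n hh. induction n as [| n IH]; simpl.
    - apply continuous_const.
    - now apply (continuous_mult h). }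
  assert (hq : continuous q (u, v)).
  { unfold q, patch. apply hsum. intros i. apply hsum. intros j.
    unfold smul. cbv zeta.
    apply (continuous_scal
             (fun z : R * R => bernstein4 i j (4 - i - j) (fst z) (snd z))
             (fun _ => control c alpha beta gamma zeta xi i j (4 - i - j)
                        : R * R * R));
      [| apply continuous_const].
    unfold bernstein4.
    apply (continuous_mult (fun _ : R * R => INR (fact 4) / INR (fact i * fact j * fact (4 - i - j))));
      [apply continuous_const |].
    apply (continuous_mult (fun z : R * R => fst z ^ i * snd z ^ j)).
    - apply (continuous_mult (fun z : R * R => fst z ^ i)); apply hpow;
        [apply continuous_fst | apply continuous_snd].
    - apply hpow.
      apply (continuous_minus (fun z : R * R => 1 - fst z) (fun z => snd z)).
      + apply (continuous_minus (fun _ : R * R => 1) (fun z => fst z)).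
        * apply continuous_const.
        * apply continuous_fst.
      + apply continuous_snd. }
  change (filterlim (fun z : R * R => norm (q z)) (locally (u, v))
            (locally (norm (q (u, v))))).
  apply (filterlim_comp _ _ _ q norm _ (locally (q (u, v)))).
  - exact hq.
  - exact (filterlim_norm (V := prod_NormedModule R_AbsRing
             (prod_NormedModule R_AbsRing R_NormedModule R_NormedModule)
             R_NormedModule) (q (u, v))).
Qed.

Lemma Rabs_continuous_2d (f : R -> R -> R) (u v : R) :
  continuity_2d_pt f u v -> continuity_2d_pt (fun u v => Rabs (f u v)) u v.
Proof.
  intros hf. apply continuity_1d_2d_pt_comp; [| exact hf].
  apply Rcontinuity_abs.
Qed.

Lemma d_s_is_max (c alpha beta gamma zeta xi : R) :
  let p := patch c alpha beta gamma zeta xi in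
  (exists u v, Delta u v /\ d_s p = Rabs (vnorm (p u v) ^ 2 - 1)) /\
  (forall u v, Delta u v -> Rabs (vnorm (p u v) ^ 2 - 1) <= d_s p).
Proof.
  intros p. apply (max_Delta_is_max (fun u v => Rabs (vnorm (p u v) ^ 2 - 1))).
  intros u v. apply Rabs_continuous_2d, continuity_2d_pt_minus;
    [| apply continuity_2d_pt_const].
  apply (continuity_1d_2d_pt_comp (fun x => x ^ 2)).
  - apply derivable_continuous_pt, derivable_pt_pow.
  - apply vnorm_patch_continuous.
Qed.

Lemma d_r_is_max (c alpha beta gamma zeta xi : R) :
  let p := patch c alpha beta gamma zeta xi in
  (exists u v, Delta u v /\ d_r p = Rabs (vnorm (p u v) - 1)) /\
  (forall u v, Delta u v -> Rabs (vnorm (p u v) - 1) <= d_r p).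
Proof.
  intros p. apply (max_Delta_is_max (fun u v => Rabs (vnorm (p u v) - 1))).
  intros u v. apply Rabs_continuous_2d, continuity_2d_pt_minus;
    [| apply continuity_2d_pt_const].
  apply vnorm_patch_continuous.
Qed.

(* Main.v *)
Require Import Defs.
From Stdlib Require Import Reals Lra Psatz Factorial.
From Coquelicot Require Import Coquelicot.
Open Scope R_scope.

(** For the tetrahedron the vertices satisfy [vi . vj = -1/3], so in the basis
    [v0, v1, v2] all conditions are polynomial. The vertex and boundary conditions,
    together with [beta <> 0] (regularity at a vertex), leave three one-parameter
    branches: the family of the statement, [beta = 9/4], and
    [beta = 9 (3 - 2 gamma) / 8]. On the last two the radial error is too large
    at one of a few test points. On the family, [|p|^2] is a polynomial in the
    symmetric functions [q = uv + vw + wu] and [r = uvw], increasing in [r]; for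
    [gamma] near [0.968] its maximum is at the center of the triangle
    (from [3 r <= q^2]) and its minimum at the edge midpoints (from Schur's
    inequality of degree 4). The norms there, [(48 gamma - 19) / 27] and
    [(1 + 6 gamma) sqrt 3 / 12], both increase with [gamma], so the optimum is where
    the two deviations from [1] balance. Regularity holds because the homogeneous
    Jacobian determinant is a positive polynomial in [q] and [r]. *)

(** * The patch and its partial derivatives in the basis of the vertices *)

Definition comb (c x y z : R) : vec :=
  vadd (vadd (smul x (v0 c)) (smul y (v1 c))) (smul z (v2 c)).

(* The coordinate of the patch along the vertex whose barycentric parameter is
   [u]; the other two are obtained by permuting [u], [v], [w]. *)
Definition quart (al be ga ze xi u v w : R) : R :=
  u ^ 4 + 4 * al * u ^ 3 * (v + w) + 4 * be * u * (v ^ 3 + w ^ 3)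
  + 6 * ga * u ^ 2 * (v ^ 2 + w ^ 2) + 12 * ze * u ^ 2 * v * w
  + 12 * xi * u * v * w * (v + w).

Lemma vec_ext (a b : vec) : xc a = xc b -> yc a = yc b -> zc a = zc b -> a = b.
Proof. destruct a as [[? ?] ?], b as [[? ?] ?]; unfold xc, yc, zc; simpl; congruence. Qed.

Lemma xc_vadd (a b : vec) : xc (vadd a b) = xc a + xc b.
Proof. reflexivity. Qed.

Lemma yc_vadd (a b : vec) : yc (vadd a b) = yc a + yc b.
Proof. reflexivity. Qed.

Lemma zc_vadd (a b : vec) : zc (vadd a b) = zc a + zc b.
Proof. reflexivity. Qed.

Lemma xc_smul (t : R) (a : vec) : xc (smul t a) = t * xc a.
Proof. reflexivity. Qed.

Lemma yc_smul (t : R) (a : vec) : yc (smul t a) = t * yc a.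
Proof. reflexivity. Qed.

Lemma zc_smul (t : R) (a : vec) : zc (smul t a) = t * zc a.
Proof. reflexivity. Qed.

Ltac vec_coords :=
  repeat first [rewrite xc_vadd | rewrite yc_vadd | rewrite zc_vadd
               | rewrite xc_smul | rewrite yc_smul | rewrite zc_smul].

Lemma patch_comb (c al be ga ze xi u v : R) :
  let w := 1 - u - v in
  patch c al be ga ze xi u v =
  comb c (quart al be ga ze xi u v w) (quart al be ga ze xi v u w)
    (quart al be ga ze xi w u v).
Proof.
  intros w. unfold patch.
  rewrite !sum_Sn, !sum_O. simpl Nat.sub. rewrite !sum_Sn, !sum_O.
  unfold bernstein4. simpl fact. rewrite !INR_IZR_INZ. simpl Z.of_nat. simpl control.
  change (@plus _) with vadd.
  unfold comb, quart, w.
  apply vec_ext; vec_coords; simpl; field.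
Qed.

Definition quart_d1 (al be ga ze xi u v w : R) : R :=
  4 * u ^ 3 + 12 * al * u ^ 2 * (v + w) + 4 * be * (v ^ 3 + w ^ 3)
  + 12 * ga * u * (v ^ 2 + w ^ 2) + 24 * ze * u * v * w
  + 12 * xi * v * w * (v + w).

(* Partial derivative of [quart] in [v]; by the symmetry of
   [quart], the third one is [quart_d2] with [v] and [w] exchanged. *)
Definition quart_d2 (al be ga ze xi u v w : R) : R :=
  4 * al * u ^ 3 + 12 * be * u * v ^ 2 + 12 * ga * u ^ 2 * v
  + 12 * ze * u ^ 2 * w + 12 * xi * u * w * (2 * v + w).

Lemma Derive_vec_comb (c t x' y' z' : R) (f : R -> vec) (x y z : R -> R) :
  (forall s, f s = comb c (x s) (y s) (z s)) ->
  is_derive x t x' -> is_derive y t y' -> is_derive z t z' ->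
  Derive_vec f t = comb c x' y' z'.
Proof.
  intros hf hx hy hz.
  assert (hD : forall (pr : vec -> R) a0 a1 a2,
    (forall s, pr (f s) = x s * a0 + y s * a1 + z s * a2) ->
    Derive (fun s => pr (f s)) t = x' * a0 + y' * a1 + z' * a2).
  { intros pr a0 a1 a2 h. apply is_derive_unique.
    apply is_derive_ext with (fun s => x s * a0 + y s * a1 + z s * a2).
    { intros s. now rewrite h. }
    apply (is_derive_plus (fun s => x s * a0 + y s * a1) (fun s => z s * a2)).
    apply (is_derive_plus (fun s => x s * a0) (fun s => y s * a1)).
    - exact (is_derive_scal_l (V := R_NormedModule) x t x' a0 hx).
    - exact (is_derive_scal_l (V := R_NormedModule) y t y' a1 hy).
    - exact (is_derive_scal_l (V := R_NormedModule) z t z' a2 hz). }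
  unfold Derive_vec, comb.
  apply vec_ext; vec_coords.
  - apply (hD xc). intros s. now rewrite hf.
  - apply (hD yc). intros s. now rewrite hf.
  - apply (hD zc). intros s. now rewrite hf.
Qed.

(** Since [w] has derivative [-1] in [u], each coordinate is the difference of the homogeneous
    partial derivatives in [u] and in [w]. With [w] a separate variable, simplified values such as
    [0] or [1 - t] can be supplied on the boundary. *)
Lemma d_u_patch (c al be ga ze xi u v w : R) :
  w = 1 - u - v ->
  d_u (patch c al be ga ze xi) u v =
  comb c (quart_d1 al be ga ze xi u v w - quart_d2 al be ga ze xi u w v)
    (quart_d2 al be ga ze xi v u w - quart_d2 al be ga ze xi v w u)
    (quart_d2 al be ga ze xi w u v - quart_d1 al be ga ze xi w u v).
Proof.
  intros ->. unfold d_u.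
  eapply Derive_vec_comb; [intros s; apply patch_comb | ..];
    unfold quart, quart_d1, quart_d2; auto_derive; trivial; ring.
Qed.

Lemma d_v_patch (c al be ga ze xi u v w : R) :
  w = 1 - u - v ->
  d_v (patch c al be ga ze xi) u v =
  comb c (quart_d2 al be ga ze xi u v w - quart_d2 al be ga ze xi u w v)
    (quart_d1 al be ga ze xi v u w - quart_d2 al be ga ze xi v w u)
    (quart_d2 al be ga ze xi w v u - quart_d1 al be ga ze xi w u v).
Proof.
  intros ->. unfold d_v.
  eapply Derive_vec_comb; [intros s; apply patch_comb | ..];
    unfold quart, quart_d1, quart_d2; auto_derive; trivial; ring.
Qed.

(** * Dot and cross products, and the Gram matrix of the tetrahedron *)

Definition dot (a b : vec) : R := xc a * xc b + yc a * yc b + zc a * zc b.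

Lemma vnorm_sq (a : vec) : vnorm a ^ 2 = dot a a.
Proof.
  destruct a as [[x y] z]. change (x, y, z) with (mkvec x y z).
  rewrite norm_euclidean, pow2_sqrt by nra.
  unfold dot, xc, yc, zc; simpl; ring.
Qed.

Lemma vnorm_ge0 (a : vec) : 0 <= vnorm a.
Proof.
  destruct a as [[x y] z]. change (x, y, z) with (mkvec x y z).
  rewrite norm_euclidean. apply sqrt_pos.
Qed.

Lemma dot_vaddl (a b n : vec) : dot (vadd a b) n = dot a n + dot b n.
Proof. unfold dot; vec_coords; ring. Qed.

Lemma dot_smull (t : R) (a n : vec) : dot (smul t a) n = t * dot a n.
Proof. unfold dot; vec_coords; ring. Qed.

Lemma dotC (a b : vec) : dot a b = dot b a.
Proof. unfold dot; ring. Qed.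

(** The Binet-Cauchy identity; it turns conditions on normals into conditions on dot products with
    the vertices. *)
Lemma dot_cross_cross (a b x y : vec) :
  dot (cross x y) (cross a b) = dot x a * dot y b - dot x b * dot y a.
Proof. unfold dot, cross, xc, yc, zc; simpl; ring. Qed.

Lemma dot_cross_l (x y : vec) : dot x (cross x y) = 0.
Proof. unfold dot, cross, xc, yc, zc; simpl; ring. Qed.

Lemma dot_cross_r (x y : vec) : dot y (cross x y) = 0.
Proof. unfold dot, cross, xc, yc, zc; simpl; ring. Qed.

Lemma in_plane_iff (a b n : vec) :
  dot (cross a b) (cross a b) <> 0 ->
  in_plane a b n <-> dot n (cross a b) = 0.
Proof.
  intros hab. split.
  - intros [s [t ->]].
    rewrite dot_vaddl, !dot_smull, dot_cross_l, dot_cross_r. ring.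
  - intros hn. set (d := dot (cross a b) (cross a b)) in *.
    exists (dot (cross n b) (cross a b) / d), (dot (cross a n) (cross a b) / d).
    (* This is Cramer's rule for [n] in the basis [a], [b], [cross a b]. *)
    assert (h : forall pr : vec -> R, (pr = xc \/ pr = yc \/ pr = zc) ->
      d * pr n = dot (cross n b) (cross a b) * pr a
        + dot (cross a n) (cross a b) * pr b + dot n (cross a b) * pr (cross a b)).
    { unfold d, dot, cross, xc, yc, zc; simpl.
      intros pr [-> | [-> | ->]]; simpl; ring. }
    apply vec_ext; vec_coords; apply (Rmult_eq_reg_l d); trivial;
      rewrite h, hn by tauto; field; trivial.
Qed.

Lemma parallel_cross (a x y : vec) :
  dot a a <> 0 -> dot x a = 0 -> dot y a = 0 -> parallel (cross x y) a.
Proof.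
  intros ha hx hy. exists (dot (cross x y) a / dot a a).
  (* With [n = cross x y], this expands [cross a (cross n a)] by the triple product rule in two
     ways. *)
  assert (h : forall pr : vec -> R, (pr = xc \/ pr = yc \/ pr = zc) ->
      dot a a * pr (cross x y) = dot (cross x y) a * pr a
      + dot x a * pr (cross a y)
      - dot y a * pr (cross a x)).
  { unfold dot, cross, mkvec, xc, yc, zc; simpl.
    intros pr [-> | [-> | ->]]; simpl; ring. }
  apply vec_ext; vec_coords; apply (Rmult_eq_reg_l (dot a a)); trivial;
    rewrite h, hx, hy by tauto; field; trivial.
Qed.

Lemma dot_vertices (c : R) :
  c ^ 2 = 8 / 9 ->
  dot (v0 c) (v0 c) = 1 /\ dot (v1 c) (v1 c) = 1 /\ dot (v2 c) (v2 c) = 1 /\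
  dot (v0 c) (v1 c) = - (1 / 3) /\ dot (v0 c) (v2 c) = - (1 / 3) /\
  dot (v1 c) (v2 c) = - (1 / 3).
Proof.
  intros hc.
  assert (hz : sqrt (1 - c ^ 2) * sqrt (1 - c ^ 2) = 1 / 9)
    by (rewrite sqrt_sqrt; lra).
  assert (h3 : sqrt 3 * sqrt 3 = 3) by (apply sqrt_sqrt; lra).
  unfold dot, v0, v1, v2, mkvec, xc, yc, zc; cbn [fst snd].
  set (z := sqrt (1 - c ^ 2)) in *. set (h := sqrt 3) in *.
  assert (hch : (h / 2 * c) * (h / 2 * c) = 2 / 3)
    by (replace ((h / 2 * c) * (h / 2 * c)) with (h * h * c ^ 2 / 4) by field;
        rewrite h3, hc; lra).
  repeat split; nra.
Qed.

Lemma dot_comb_vertices (c x y z : R) :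
  c ^ 2 = 8 / 9 ->
  dot (comb c x y z) (v0 c) = x - (y + z) / 3 /\
  dot (comb c x y z) (v1 c) = y - (x + z) / 3 /\
  dot (comb c x y z) (v2 c) = z - (x + y) / 3.
Proof.
  intros hc.
  destruct (dot_vertices c hc) as [h00 [h11 [h22 [h01 [h02 h12]]]]].
  unfold comb. rewrite !dot_vaddl, !dot_smull.
  rewrite (dotC (v1 c) (v0 c)), (dotC (v2 c) (v0 c)), (dotC (v2 c) (v1 c)).
  rewrite h00, h11, h22, h01, h02, h12. lra.
Qed.

Lemma vnorm_comb_sq (c x y z : R) :
  c ^ 2 = 8 / 9 ->
  vnorm (comb c x y z) ^ 2
  = x ^ 2 + y ^ 2 + z ^ 2 - 2 / 3 * (x * y + y * z + x * z).
Proof.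
  intros hc. rewrite vnorm_sq. unfold comb at 1.
  rewrite !dot_vaddl, !dot_smull, !(dotC _ (comb c x y z)).
  destruct (dot_comb_vertices c x y z hc) as [-> [-> ->]]. field.
Qed.

Lemma comb_eq0 (c x y z : R) :
  c ^ 2 = 8 / 9 -> comb c x y z = vzero -> x = 0 /\ y = 0 /\ z = 0.
Proof.
  intros hc h. destruct (dot_comb_vertices c x y z hc) as [h0 [h1 h2]].
  rewrite h in h0, h1, h2.
  assert (hd : forall a, dot vzero a = 0)
    by (intros a; change (0 * xc a + 0 * yc a + 0 * zc a = 0); ring).
  rewrite hd in h0, h1, h2. lra.
Qed.

(** * The one-parameter family and its squared norm *)

Definition tetra_patch (c g : R) : R -> R -> vec :=
  patch c ((6 * g + 13) / 16) (9 * (2 * g - 1) / 16) g ((18 * g - 1) / 8)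
    ((62 * g - 39) / 16).

Lemma family_patch_tetra (c g : R) :
  c ^ 2 = 8 / 9 -> family_patch c g = tetra_patch c g.
Proof.
  intros hc. unfold family_patch, tetra_patch, alpha_of, beta_of, zeta_of, xi_of.
  replace (c ^ 6) with ((c ^ 2) ^ 3) by ring.
  replace (c ^ 4) with ((c ^ 2) ^ 2) by ring.
  rewrite hc. f_equal; field.
Qed.

(* [q = uv + vw + wu] and [r = uvw] are the elementary symmetric functions of
   the barycentric parameters, whose sum is [1]. *)
Definition sqnorm_poly (g q r : R) : R :=
  1 - (15 / 2 + 10 * g - 18 * g ^ 2) * (q ^ 2 - 3 * r)
  - 2 / 3 * (7 - 6 * g) ^ 2 * q * (q + 6 * r) ^ 2
  + (87 - 332 * g + 252 * g ^ 2) * q * r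
  + (1299 - 3036 * g + 1836 * g ^ 2) * r ^ 2.

Lemma tetra_patch_sqnorm (c g u v w : R) :
  c ^ 2 = 8 / 9 -> w = 1 - u - v ->
  vnorm (tetra_patch c g u v) ^ 2
  = sqnorm_poly g (u * v + v * w + w * u) (u * v * w).
Proof.
  intros hc ->. unfold tetra_patch. rewrite patch_comb, vnorm_comb_sq by trivial.
  unfold quart, sqnorm_poly. field.
Qed.

(** * Inequalities between [q] and [r], and bounds for the squared norm *)

Lemma schur4_ordered (u v w : R) :
  0 <= w -> w <= v -> v <= u ->
  0 <= u ^ 2 * (u - v) * (u - w) + v ^ 2 * (v - u) * (v - w)
       + w ^ 2 * (w - u) * (w - v).
Proof.
  intros hw hv hu.
  replace (u ^ 2 * (u - v) * (u - w) + v ^ 2 * (v - u) * (v - w)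
       + w ^ 2 * (w - u) * (w - v))
    with ((u - v) ^ 2 * ((u + v) * (u - w) + v ^ 2) + w ^ 2 * ((u - w) * (v - w)))
    by ring.
  assert (0 <= (u + v) * (u - w)) by (apply Rmult_le_pos; lra).
  assert (0 <= (u - w) * (v - w)) by (apply Rmult_le_pos; lra).
  assert (0 <= (u - v) ^ 2 * ((u + v) * (u - w) + v ^ 2)).
  { apply Rmult_le_pos; nra. }
  assert (0 <= w ^ 2 * ((u - w) * (v - w))) by (apply Rmult_le_pos; nra).
  lra.
Qed.

Lemma schur4 (u v w : R) :
  0 <= u -> 0 <= v -> 0 <= w ->
  0 <= u ^ 2 * (u - v) * (u - w) + v ^ 2 * (v - u) * (v - w)
       + w ^ 2 * (w - u) * (w - v).
Proof.
  intros hu hv hw.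
  destruct (Rle_lt_dec u v), (Rle_lt_dec v w), (Rle_lt_dec u w); try lra;
  [ pose proof (schur4_ordered w v u) | pose proof (schur4_ordered v w u)
  | pose proof (schur4_ordered v u w) | pose proof (schur4_ordered w u v)
  | pose proof (schur4_ordered u w v)
  | pose proof (schur4_ordered u v w) ]; lra.
Qed.

Lemma simplex_qr (u v w : R) :
  0 <= u -> 0 <= v -> 0 <= w -> u + v + w = 1 ->
  let q := u * v + v * w + w * u in
  let r := u * v * w in
  0 <= q <= 1 / 3 /\ 0 <= r /\ 9 * r <= q /\ 3 * r <= q ^ 2 /\
  (4 * q - 1) * (1 - q) <= 6 * r.
Proof.
  intros hu hv hw hs q r.
  assert (huv : 0 <= u * v) by nra. assert (hvw : 0 <= v * w) by nra.
  assert (hwu : 0 <= w * u) by nra.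
  assert (hq : q <= 1 / 3).
  { unfold q. replace w with (1 - u - v) by lra.
    assert (h1 := pow2_ge_0 (u - v)). assert (h2 := pow2_ge_0 (u + v - 2 / 3)). nra. }
  assert (h3 : 3 * r <= q ^ 2).
  { assert (h1 := pow2_ge_0 (u * v - v * w)). assert (h2 := pow2_ge_0 (v * w - w * u)).
    assert (h4 := pow2_ge_0 (w * u - u * v)).
    (* Made homogeneous by [u + v + w = 1], the difference [q^2 - 3 r] is half the sum of the three
       squares above. *)
    replace (3 * r) with (3 * r * (u + v + w)) by (rewrite hs; ring).
    unfold q, r. nra. }
  assert (hr : 0 <= r) by (unfold r; apply Rmult_le_pos; lra).
  repeat split; try (unfold q in *; lra).
  - unfold q in *; nra.
  - assert (h := schur4 u v w hu hv hw).
    replace (u ^ 2 * (u - v) * (u - w) + v ^ 2 * (v - u) * (v - w)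
       + w ^ 2 * (w - u) * (w - v)) with (6 * r - (4 * q - 1) * (1 - q)) in h; [lra|].
    unfold q, r. replace w with (1 - u - v) by lra. ring.
Qed.

(** The four coefficients satisfy a linear relation, so three letters suffice. Their narrow ranges
    then replace the dependence on [g] in the estimates. The last equation is the value at
    [q = 1/4], [r = 0], the edge midpoint. *)
Lemma sqnorm_poly_coef (g : R) :
  967 / 1000 <= g <= 969 / 1000 ->
  exists l k m, (28 / 100 <= l <= 35 / 100 /\ 93 / 100 <= k <= 96 / 100 /\
    80 <= m <= 82) /\
  (forall q r, sqnorm_poly g q r = 1 - l * (q ^ 2 - 3 * r) - k * q * (q + 6 * r) ^ 2
    + (9 / 2 * k - 8 * l) * q * r + m * r ^ 2) /\
  (1 + 6 * g) ^ 2 / 48 = 1 - l / 16 - k / 64.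
Proof.
  intros hg. exists (15 / 2 + 10 * g - 18 * g ^ 2), (2 / 3 * (7 - 6 * g) ^ 2),
    (1299 - 3036 * g + 1836 * g ^ 2).
  split; [repeat split; nra | split].
  - intros q r. unfold sqnorm_poly. field.
  - field.
Qed.

(** The difference is divisible by [r2 - r1]. In the cofactor, [36 k q < 12] is far below [m], and
    the part free of [r1] and [r2] is dominated by [3 l]. *)
Lemma sqnorm_poly_mono (g q r1 r2 : R) :
  967 / 1000 <= g <= 969 / 1000 -> 0 <= q <= 1 / 3 -> 0 <= r1 -> r1 <= r2 ->
  sqnorm_poly g q r1 <= sqnorm_poly g q r2.
Proof.
  intros hg hq h1 h2.
  destruct (sqnorm_poly_coef g hg) as [l [k [m [[hl [hk hm]] [hp _]]]]].
  assert (h : sqnorm_poly g q r2 - sqnorm_poly g q r1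
    = (r2 - r1) * (3 * l + (9 / 2 * k - 8 * l) * q - 12 * k * q ^ 2
                   + (m - 36 * k * q) * (r1 + r2)))
    by (rewrite !hp; ring).
  assert (hkq : 0 <= k * q <= 33 / 100) by nra.
  assert (hlq : l * q <= 35 / 300) by nra.
  assert (0 <= 3 * l + (9 / 2 * k - 8 * l) * q - 12 * k * q ^ 2).
  { assert (k * q ^ 2 <= k * q / 3) by nra. nra. }
  assert (0 <= (m - 36 * k * q) * (r1 + r2)) by (apply Rmult_le_pos; lra).
  assert (0 <= (r2 - r1) * (3 * l + (9 / 2 * k - 8 * l) * q - 12 * k * q ^ 2
                   + (m - 36 * k * q) * (r1 + r2))) by (apply Rmult_le_pos; lra).
  lra.
Qed.

Lemma sqnorm_poly_le (g q r : R) :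
  967 / 1000 <= g <= 969 / 1000 -> 0 <= q <= 1 / 3 -> 0 <= r -> 3 * r <= q ^ 2 ->
  sqnorm_poly g q r <= ((48 * g - 19) / 27) ^ 2.
Proof.
  intros hg hq h0 hr.
  apply Rle_trans with (sqnorm_poly g q (q ^ 2 / 3)).
  { apply sqnorm_poly_mono; lra. }
  replace (((48 * g - 19) / 27) ^ 2) with (sqnorm_poly g (1 / 3) ((1 / 3) ^ 2 / 3))
    by (unfold sqnorm_poly; field).
  destruct (sqnorm_poly_coef g hg) as [l [k [m [[hl [hk hm]] [hp _]]]]].
  rewrite !hp.
  (* On the curve [r = q^2 / 3] the term in [l (q^2 - 3 r)] vanishes and the polynomial becomes
     [1 + q^3 P(q)]; the center is [q = 1/3]. *)
  set (P := fun q => (9 / 2 * k - 8 * l) / 3 - k * (1 + 2 * q) ^ 2 + m * q / 9).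
  assert (hP : P q <= P (1 / 3)).
  { assert (h : P (1 / 3) - P q = (1 / 3 - q) * (m / 9 - 4 * k - 4 * k * (q + 1 / 3)))
      by (unfold P; field).
    assert (0 <= (1 / 3 - q) * (m / 9 - 4 * k - 4 * k * (q + 1 / 3)))
      by (apply Rmult_le_pos; nra).
    lra. }
  assert (hP0 : 0 <= P (1 / 3)) by (unfold P; lra).
  assert (hq3 : 0 <= q ^ 3 <= 1 / 27).
  { split; [apply pow_le; lra |].
    replace (1 / 27) with ((1 / 3) ^ 3) by field. apply pow_incr; lra. }
  assert (q ^ 3 * P q <= 1 / 27 * P (1 / 3)) by nra.
  unfold P in *. nra.
Qed.

Lemma sqnorm_poly_ge (g q r : R) :
  967 / 1000 <= g <= 969 / 1000 -> 0 <= q <= 1 / 3 -> 0 <= r ->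
  (4 * q - 1) * (1 - q) <= 6 * r ->
  (1 + 6 * g) ^ 2 / 48 <= sqnorm_poly g q r.
Proof.
  intros hg hq h0 hr.
  destruct (sqnorm_poly_coef g hg) as [l [k [m [[hl [hk hm]] [hp ->]]]]].
  (* The lower bounds [0] and Schur's for [r] cross at [q = 1/4], exactly where the minimum is
     attained. *)
  destruct (Rle_lt_dec q (1 / 4)) as [h4 | h4].
  - apply Rle_trans with (sqnorm_poly g q 0); [| apply sqnorm_poly_mono; lra].
    rewrite hp.
    assert (q ^ 2 <= 1 / 16) by nra. assert (q ^ 3 <= 1 / 64) by nra.
    nra.
  - apply Rle_trans with (sqnorm_poly g q ((4 * q - 1) * (1 - q) / 6));
      [| apply sqnorm_poly_mono; nra].
    rewrite hp. set (x := q - 1 / 4). replace q with (1 / 4 + x) by (unfold x; ring).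
    assert (hx : 0 <= x <= 1 / 12) by (unfold x; lra). clearbody x.
    (* The linear term in [x] cancels: the excess over the midpoint value is [x^2] times this
       cofactor. *)
    assert (hc : 0 <= - (17 / 3) * l + m / 4 - 4 * k
      + x * (16 / 3 * l - 2 / 3 * m - 9 * k)
      + x ^ 2 * (4 / 9 * m + k * (28 - 16 * x))).
    { assert (- 65 / 12 <= x * (16 / 3 * l - 2 / 3 * m - 9 * k)) by nra.
      assert (0 <= x ^ 2 * (4 / 9 * m + k * (28 - 16 * x)))
        by (apply Rmult_le_pos; nra).
      lra. }
    assert (h := Rmult_le_pos _ _ (pow2_ge_0 x) hc). nra.
Qed.

(** * The Jacobian and the admissibility of the family *)

(** The determinant of the homogeneous partial derivatives of the three coordinates, reduced by
    [u + v + w = 1]; see [tetra_jacobian]. *)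
Definition jac_poly (g q r : R) : R :=
  81 * (1 - 2 * g) ^ 2 * (1 / 4 + q)
  + (- 2241 / 2 + 2673 * g - 1278 * g ^ 2 - 324 * g ^ 3) * q ^ 2
  + (945 - 4086 * g + 5580 * g ^ 2 - 2376 * g ^ 3) * q ^ 3
  + (2727 / 2 - 1755 * g - 702 * g ^ 2 + 972 * g ^ 3) * r
  + (- 6183 / 2 + 13761 * g - 17082 * g ^ 2 + 6156 * g ^ 3) * q * r
  + (3906 - 17964 * g + 26136 * g ^ 2 - 11664 * g ^ 3) * q ^ 2 * r
  + (3213 / 2 + 22941 * g - 53730 * g ^ 2 + 28188 * g ^ 3) * r ^ 2
  + (- 27342 + 94500 * g - 101736 * g ^ 2 + 34992 * g ^ 3) * q * r ^ 2
  + (- 100548 + 331128 * g - 346032 * g ^ 2 + 116640 * g ^ 3) * r ^ 3.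

Lemma jac_poly_pos (g q r : R) :
  967 / 1000 <= g <= 969 / 1000 -> 0 <= q <= 1 / 3 -> 0 <= r -> 9 * r <= q ->
  0 < jac_poly g q r.
Proof.
  intros hg hq hr hrq. unfold jac_poly.
  (* Centering makes the powers of [x] tiny, so each coefficient gets a numerical bound. Nonnegative
     terms are then dropped; the negative ones are bounded by multiples of [q] totalling less than
     [33 q], against [70 (1/4 + q)]. *)
  set (x := g - 968 / 1000). replace g with (968 / 1000 + x) by (unfold x; ring).
  assert (hx : - 1 / 1000 <= x <= 1 / 1000) by (unfold x; lra). clearbody x.
  assert (hx2 : 0 <= x ^ 2 <= 1 / 1000000) by nra.
  assert (hx3 : - 1 / 1000000000 <= x ^ 3 <= 1 / 1000000000) by (split; nra).
  match goal with |- 0 < 81 * ?a * (1 / 4 + _) + ?b * _ + ?c * _ + ?d * _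
      + ?e * _ * _ + ?f * _ * _ + ?h * _ + ?i * _ * _ + ?j * _ =>
    assert (ha : 81 * a >= 70) by nra;
    assert (hb : - 26 <= b) by nra;
    assert (hc : 0 <= c) by nra;
    assert (hd : - 112 <= d) by nra;
    assert (he : - 196 <= e) by nra;
    assert (hf : 0 <= f) by nra;
    assert (hh : - 968 <= h) by nra;
    assert (hi : 0 <= i) by nra;
    assert (hj : 0 <= j) by nra;
    revert ha hb hc hd he hf hh hi hj;
    generalize a, b, c, d, e, f, h, i, j
  end.
  intros a0 b0 c0 d0 e0 f0 h0 i0 j0 ha hb hc hd he hf hh hi hj.
  assert (hq2 : 0 <= q ^ 2 <= q / 3) by nra.
  assert (hqr : 0 <= q * r <= q / 27) by nra.
  assert (hr2 : 0 <= r ^ 2 <= q / 243) by nra.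
  assert (0 <= c0 * q ^ 3) by (apply Rmult_le_pos; [lra | apply pow_le; lra]).
  assert (0 <= f0 * q ^ 2 * r) by (repeat apply Rmult_le_pos; lra).
  assert (0 <= i0 * q * r ^ 2) by (repeat apply Rmult_le_pos; lra).
  assert (0 <= j0 * r ^ 3) by (apply Rmult_le_pos; [lra | apply pow_le; lra]).
  assert (- 26 / 3 * q <= b0 * q ^ 2) by nra.
  assert (- 112 / 9 * q <= d0 * r) by nra.
  assert (- 196 / 27 * q <= e0 * q * r) by nra.
  assert (- 968 / 243 * q <= h0 * r ^ 2) by nra.
  assert (70 * (1 / 4 + q) <= 81 * a0 * (1 / 4 + q)) by nra.
  lra.
Qed.

Lemma tetra_jacobian (g u v w : R) :
  w = 1 - u - v ->
  let D1 := quart_d1 ((6 * g + 13) / 16) (9 * (2 * g - 1) / 16) g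
              ((18 * g - 1) / 8) ((62 * g - 39) / 16) in
  let D2 := quart_d2 ((6 * g + 13) / 16) (9 * (2 * g - 1) / 16) g
              ((18 * g - 1) / 8) ((62 * g - 39) / 16) in
  D1 u v w * (D1 v u w * D1 w u v - D2 w v u * D2 v w u)
  - D2 v u w * (D2 u v w * D1 w u v - D2 w v u * D2 u w v)
  + D2 w u v * (D2 u v w * D2 v w u - D1 v u w * D2 u w v)
  = jac_poly g (u * v + v * w + w * u) (u * v * w).
Proof.
  intros -> D1 D2. unfold D1, D2, quart_d1, quart_d2, jac_poly. field.
Qed.

Lemma cross_in_plane_iff (a b x y : vec) :
  dot a a = 1 -> dot b b = 1 -> dot a b = - (1 / 3) ->
  in_plane a b (cross x y) <-> dot x a * dot y b = dot x b * dot y a.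
Proof.
  intros ha hb hab.
  rewrite in_plane_iff; rewrite dot_cross_cross.
  - lra.
  - rewrite (dotC b a), ha, hb, hab. lra.
Qed.

Lemma tetra_regular (c g : R) :
  c ^ 2 = 8 / 9 -> 967 / 1000 <= g <= 969 / 1000 -> regular (tetra_patch c g).
Proof.
  intros hc hg u v [hu [hv huv]] s t.
  set (w := 1 - u - v).
  unfold tetra_patch.
  rewrite (d_u_patch _ _ _ _ _ _ u v w), (d_v_patch _ _ _ _ _ _ u v w) by reflexivity.
  assert (hJ := tetra_jacobian g u v w eq_refl). cbv zeta in hJ.
  destruct (simplex_qr u v w) as [hq [hr [hrq _]]]; [unfold w; lra .. |].
  assert (hpos := jac_poly_pos g _ _ hg hq hr hrq). rewrite <- hJ in hpos. clear hJ.
  match goal with |- vadd (smul s (comb c (?a1 - ?a3) (?b1 - ?b3) (?c1 - ?c3)))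
                      (smul t (comb c (?a2 - _) (?b2 - _) (?c2 - _))) = _ -> _ =>
    generalize dependent a1; generalize dependent a2; generalize dependent a3;
    generalize dependent b1; generalize dependent b2; generalize dependent b3;
    generalize dependent c1; generalize dependent c2; generalize dependent c3
  end.
  intros c3 c2 c1 b3 b2 b1 a3 a2 a1 hpos h.
  assert (hcomb : comb c (s * (a1 - a3) + t * (a2 - a3))
    (s * (b1 - b3) + t * (b2 - b3)) (s * (c1 - c3) + t * (c2 - c3)) = vzero).
  { rewrite <- h. unfold comb. apply vec_ext; vec_coords; ring. }
  destruct (comb_eq0 _ _ _ _ hc hcomb) as [ea [eb ec]].
  match type of hpos with 0 < ?d => set (D := d) in * end.
  split; apply (Rmult_eq_reg_l D); try lra.
  (* Cramer's rule: the vanishing combination has coefficients [s], [t], [- (s + t)] on the columns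
     of the Jacobian matrix, so substituting it for a column multiplies [D] by [s] or [t]. *)
  - replace (D * s) with ((s * (a1 - a3) + t * (a2 - a3)) * (b2 * c3 - b3 * c2)
      - (s * (b1 - b3) + t * (b2 - b3)) * (a2 * c3 - a3 * c2)
      + (s * (c1 - c3) + t * (c2 - c3)) * (a2 * b3 - a3 * b2)) by (unfold D; ring).
    rewrite ea, eb, ec. ring.
  - replace (D * t) with (- (s * (a1 - a3) + t * (a2 - a3)) * (b1 * c3 - b3 * c1)
      + (s * (b1 - b3) + t * (b2 - b3)) * (a1 * c3 - a3 * c1)
      - (s * (c1 - c3) + t * (c2 - c3)) * (a1 * b3 - a3 * b1)) by (unfold D; ring).
    rewrite ea, eb, ec. ring.
Qed.

Lemma tetra_vertex_normals (c g : R) :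
  c ^ 2 = 8 / 9 -> vertex_normals c (tetra_patch c g).
Proof.
  intros hc.
  destruct (dot_vertices c hc) as [h00 [h11 [h22 _]]].
  unfold vertex_normals, normal, tetra_patch.
  rewrite (d_u_patch _ _ _ _ _ _ 1 0 0), (d_v_patch _ _ _ _ _ _ 1 0 0) by ring.
  rewrite (d_u_patch _ _ _ _ _ _ 0 1 0), (d_v_patch _ _ _ _ _ _ 0 1 0) by ring.
  rewrite (d_u_patch _ _ _ _ _ _ 0 0 1), (d_v_patch _ _ _ _ _ _ 0 0 1) by ring.
  split; [| split]; apply parallel_cross; try lra;
    match goal with |- dot (comb c ?x ?y ?z) _ = _ =>
      destruct (dot_comb_vertices c x y z hc) as [e0 [e1 e2]];
      first [rewrite e0 | rewrite e1 | rewrite e2] end;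
    unfold quart_d1, quart_d2; field.
Qed.

Lemma tetra_boundary_normals (c g : R) :
  c ^ 2 = 8 / 9 -> boundary_normals c (tetra_patch c g).
Proof.
  intros hc t ht.
  destruct (dot_vertices c hc) as [h00 [h11 [h22 [h01 [h02 h12]]]]].
  unfold normal, tetra_patch.
  rewrite (d_u_patch _ _ _ _ _ _ t (1 - t) 0), (d_v_patch _ _ _ _ _ _ t (1 - t) 0) by ring.
  rewrite (d_u_patch _ _ _ _ _ _ 0 t (1 - t)), (d_v_patch _ _ _ _ _ _ 0 t (1 - t)) by ring.
  rewrite (d_u_patch _ _ _ _ _ _ t 0 (1 - t)), (d_v_patch _ _ _ _ _ _ t 0 (1 - t)) by ring.
  split; [| split]; rewrite cross_in_plane_iff by assumption;
    match goal with |- dot (comb c ?x ?y ?z) _ * dot (comb c ?x' ?y' ?z') _ = _ =>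
      destruct (dot_comb_vertices c x y z hc) as [e0 [e1 e2]];
      destruct (dot_comb_vertices c x' y' z' hc) as [e0' [e1' e2']];
      rewrite ?e0, ?e1, ?e2, ?e0', ?e1', ?e2' end;
    unfold quart_d1, quart_d2; field.
Qed.

Lemma tetra_admissible (c g : R) :
  c ^ 2 = 8 / 9 -> 967 / 1000 <= g <= 969 / 1000 ->
  G1_admissible c (tetra_patch c g).
Proof.
  intros hc hg. split; [| split].
  - now apply tetra_regular.
  - now apply tetra_vertex_normals.
  - now apply tetra_boundary_normals.
Qed.

(** * Necessary conditions for admissibility *)

(* The coefficients of [t^2 (1-t)^4] and [t^3 (1-t)^3] in the boundary condition
   along an edge, after elimination of [al] and [ze]. *)
Definition edge_relation2 (be ga xi : R) : R :=
  93 * be - 38 * be * ga - 8 * be ^ 2 - 27 * ga + 18 * ga ^ 2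
  + (- 27 - 8 * be + 18 * ga) * xi.

Definition edge_relation3 (be ga xi : R) : R :=
  - 162 - 27 * be + 18 * be * ga - 56 * be ^ 2 + 297 * ga - 54 * ga ^ 2
  + (- 27 + 72 * be - 54 * ga) * xi.

Lemma admissible_relations (c al be ga ze xi : R) :
  c ^ 2 = 8 / 9 -> G1_admissible c (patch c al be ga ze xi) ->
  be <> 0 /\ al = 1 + be / 3 /\ ze = 3 / 2 - ga / 3 + 2 / 3 * xi /\
  edge_relation2 be ga xi = 0 /\ edge_relation3 be ga xi = 0.
Proof.
  intros hc [hreg [[hv _] hb]].
  destruct (dot_vertices c hc) as [h00 [h11 [h22 [h01 [h02 h12]]]]].
  (* At [v0] the derivative in [v] is [4 be (v1 - v2)], which must not vanish. *)
  assert (hbe : be <> 0).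
  { intros h0. assert (hD : Defs.Delta 1 0) by (unfold Defs.Delta; lra).
    assert (h : 0 = 0 /\ 1 = 0); [apply (hreg 1 0 hD) | lra].
    rewrite (d_u_patch _ _ _ _ _ _ 1 0 0), (d_v_patch _ _ _ _ _ _ 1 0 0) by ring.
    unfold comb, quart_d1, quart_d2. rewrite h0.
    apply vec_ext; vec_coords; change (xc vzero) with 0; change (yc vzero) with 0;
      change (zc vzero) with 0; ring. }
  assert (hal : al = 1 + be / 3).
  { destruct hv as [s hs]. unfold normal in hs.
    rewrite (d_u_patch _ _ _ _ _ _ 1 0 0), (d_v_patch _ _ _ _ _ _ 1 0 0) in hs by ring.
    (* Pairing with [cross (v0 c) (v1 c)] eliminates the unknown factor [s]; what remains is a
       multiple of [be]. *)
    apply (f_equal (fun n => dot n (cross (v0 c) (v1 c)))) in hs.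
    rewrite dot_cross_cross, dot_smull, dot_cross_l in hs.
    match type of hs with dot (comb c ?x ?y ?z) _ * dot (comb c ?x' ?y' ?z') _ - _ = _ =>
      destruct (dot_comb_vertices c x y z hc) as [e0 [e1 _]];
      destruct (dot_comb_vertices c x' y' z' hc) as [e0' [e1' _]];
      rewrite e0, e1, e0', e1' in hs end.
    unfold quart_d1, quart_d2 in hs.
    apply (Rmult_eq_reg_l be); [| trivial]. nra. }
  (* The condition is symmetric under [t <-> 1 - t], so it is a polynomial in
     [x = t (1 - t)]; three parameters determine its coefficients. *)
  set (C1 := 64 - 128 / 9 * ga + 256 / 9 * xi - 128 / 3 * ze).
  set (C2 := 64 / 9 * be - 128 / 3 * be * ga - 1024 / 9 * be * xi + 1280 / 9 * be * ze
    - 512 / 27 * be ^ 2 + 128 * ga + 128 * ga * xi - 128 * ga * ze - 64 * xi).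
  set (C3 := 128 + 256 / 3 * be + 512 / 3 * be * xi - 256 / 3 * be * ze
    - 7168 / 81 * be ^ 2 - 256 * ga * xi + 256 * ga * ze + 128 * xi - 256 * ze).
  (* Here [1 - 4 x + 2 x^2 = t^4 + (1-t)^4] and [1 - 2 x = t^2 + (1-t)^2], so [be C1], [C2], [C3]
     are the coefficients of the symmetric form of degree 6 in [t] and [1 - t]. *)
  assert (hC : forall t, 0 <= t <= 1 -> let x := t * (1 - t) in
    x * ((1 - 4 * x + 2 * x ^ 2) * (be * C1) + x * (1 - 2 * x) * C2 + x ^ 2 * C3) = 0).
  { intros t ht x. destruct (hb t ht) as [h _]. unfold normal in h.
    rewrite (d_u_patch _ _ _ _ _ _ t (1 - t) 0), (d_v_patch _ _ _ _ _ _ t (1 - t) 0)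
      in h by ring.
    rewrite cross_in_plane_iff in h by assumption.
    match type of h with dot (comb c ?x ?y ?z) _ * dot (comb c ?x' ?y' ?z') _ = _ =>
      destruct (dot_comb_vertices c x y z hc) as [e0 [e1 _]];
      destruct (dot_comb_vertices c x' y' z' hc) as [e0' [e1' _]];
      rewrite e0, e1, e0', e1' in h end.
    apply Rminus_diag_eq in h. rewrite <- h, hal.
    unfold quart_d1, quart_d2, x, C1, C2, C3. field. }
  assert (h1 := hC (1 / 2) ltac:(lra)). assert (h2 := hC (1 / 3) ltac:(lra)).
  assert (h3 := hC (1 / 4) ltac:(lra)). cbv zeta in h1, h2, h3.
  assert (hC1 : be * C1 = 0) by lra.
  assert (hC2 : C2 = 0) by lra.
  assert (hC3 : C3 = 0) by lra.
  assert (hze : ze = 3 / 2 - ga / 3 + 2 / 3 * xi).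
  { apply Rmult_integral in hC1. destruct hC1 as [h | h]; [contradiction |].
    unfold C1 in h. lra. }
  repeat split; trivial.
  - rewrite <- (Rmult_0_r (27 / 64)), <- hC2. unfold edge_relation2, C2.
    rewrite hze. field.
  - rewrite <- (Rmult_0_r (81 / 128)), <- hC3. unfold edge_relation3, C3.
    rewrite hze. field.
Qed.

(** Both relations are affine in [xi]; eliminating it leaves a product of three linear factors. *)
Lemma edge_relations_branches (be ga xi : R) :
  edge_relation2 be ga xi = 0 -> edge_relation3 be ga xi = 0 ->
  be = 9 * (2 * ga - 1) / 16 \/ be = 9 / 4 \/ be = 9 * (3 - 2 * ga) / 8.
Proof.
  unfold edge_relation2, edge_relation3. intros h2 h3.
  assert (h : (be - 9 * (2 * ga - 1) / 16)
              * ((be - 9 / 4) * (be - 9 * (3 - 2 * ga) / 8)) = 0).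
  { match type of h2 with ?p + ?p' * _ = _ => match type of h3 with ?q + ?q' * _ = _ =>
      replace (_ * _) with (- (1 / 1024) * ((p + p' * xi) * q' - (q + q' * xi) * p'))
        by field end end.
    rewrite h2, h3. ring. }
  apply Rmult_integral in h. destruct h as [h | h]; [left; lra |].
  apply Rmult_integral in h. destruct h as [h | h]; right; [left | right]; lra.
Qed.

(** * Test points on an arbitrary admissible patch *)

Lemma patch_edge_sqnorm (c al be ga ze xi t s : R) :
  c ^ 2 = 8 / 9 -> s = 1 - t ->
  let x := t ^ 4 + 4 * al * t ^ 3 * s + 6 * ga * t ^ 2 * s ^ 2 + 4 * be * t * s ^ 3 in
  let y := s ^ 4 + 4 * al * s ^ 3 * t + 6 * ga * s ^ 2 * t ^ 2 + 4 * be * s * t ^ 3 in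
  vnorm (patch c al be ga ze xi t s) ^ 2 = x ^ 2 + y ^ 2 - 2 / 3 * (x * y).
Proof.
  intros hc -> x y. rewrite patch_comb, vnorm_comb_sq by trivial.
  unfold quart, x, y. field.
Qed.

(** By symmetry the center is a multiple of [v0 + v1 + v2], a unit vector for the tetrahedron. *)
Lemma patch_center_sqnorm (c al be ga ze xi : R) :
  c ^ 2 = 8 / 9 ->
  vnorm (patch c al be ga ze xi (1 / 3) (1 / 3)) ^ 2
  = ((1 + 8 * al + 8 * be + 12 * ga + 12 * ze + 24 * xi) / 81) ^ 2.
Proof.
  intros hc. rewrite patch_comb, vnorm_comb_sq by trivial. unfold quart. field.
Qed.

Lemma admissible_witness (c al be ga ze xi g : R) :
  c ^ 2 = 8 / 9 -> 9679 / 10000 <= g <= 9681 / 10000 ->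
  G1_admissible c (patch c al be ga ze xi) ->
  exists u v, Defs.Delta u v /\
   (((48 * g - 19) / 27) ^ 2 <= vnorm (patch c al be ga ze xi u v) ^ 2 \/
    vnorm (patch c al be ga ze xi u v) ^ 2 <= (1 + 6 * g) ^ 2 / 48).
Proof.
  intros hc hg hadm.
  destruct (admissible_relations _ _ _ _ _ _ hc hadm) as [hbe [hal [hze [h2 h3]]]].
  set (p := patch c al be ga ze xi).
  assert (hcen : vnorm (p (1 / 3) (1 / 3)) ^ 2
    = ((27 + 32 / 3 * be + 8 * ga + 32 * xi) / 81) ^ 2).
  { unfold p. rewrite patch_center_sqnorm, hal, hze by trivial. field. }
  assert (hmid : vnorm (p (1 / 2) (1 / 2)) ^ 2
    = (15 + 16 * be + 18 * ga) ^ 2 / 1728).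
  { unfold p. rewrite (patch_edge_sqnorm _ _ _ _ _ _ _ (1 / 2)), hal by lra. field. }
  (* These constants replace [g] in the two extraneous branches. *)
  assert (hs : 0 <= ((48 * g - 19) / 27) ^ 2 <= 1036 / 1000) by nra.
  assert (hm : 965 / 1000 <= (1 + 6 * g) ^ 2 / 48) by nra.
  assert (hDc : Defs.Delta (1 / 3) (1 / 3)) by (unfold Defs.Delta; lra).
  assert (hDm : Defs.Delta (1 / 2) (1 / 2)) by (unfold Defs.Delta; lra).
  set (good := fun u v => ((48 * g - 19) / 27) ^ 2 <= vnorm (p u v) ^ 2 \/
    vnorm (p u v) ^ 2 <= (1 + 6 * g) ^ 2 / 48).
  change (exists u v, Defs.Delta u v /\ good u v).
  assert (center : good (1 / 3) (1 / 3) -> exists u v, Defs.Delta u v /\ good u v)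
    by eauto.
  assert (mid : good (1 / 2) (1 / 2) -> exists u v, Defs.Delta u v /\ good u v)
    by eauto.
  unfold good in center, mid. rewrite hcen in center. rewrite hmid in mid.
  destruct (edge_relations_branches _ _ _ h2 h3) as [hb | [hb | hb]];
    unfold edge_relation2, edge_relation3 in *; rewrite hb in h2, h3, center, mid.
  (* At [ga = 5/2] both relations lose [xi], but the midpoint value is free of [xi] and already too
     large. *)
  - destruct (Req_dec ga (5 / 2)) as [-> | h5].
    { apply mid. left. lra. }
    assert (hxi : xi = (62 * ga - 39) / 16).
    { apply (Rmult_eq_reg_l (ga - 5 / 2)); [nra | lra]. }
    rewrite hxi in center.
    (* The value [- 1/3 - g] is the reflection of [g] in the zero [-1/6] of [1 + 6 ga]: between the
       two, the midpoint norm does not exceed its value at [g]. *)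
    destruct (Rle_lt_dec g ga) as [h | h]; [| destruct (Rle_lt_dec (- 1 / 3 - g) ga)].
    + apply center. left. nra.
    + apply mid. right. nra.
    + apply center. left. nra.
  - destruct (Rle_lt_dec 2 ga) as [h | h].
    + apply mid. left. nra.
    + assert (hxi : xi = 15 / 4 - ga).
      { apply (Rmult_eq_reg_l (ga - 5 / 2)); [nra | lra]. }
      apply center. left. rewrite hxi. nra.
  (* In this branch [be = - 9/4 (ga - 3/2)], so [be <> 0] permits solving the first relation for
     [xi]. *)
  - assert (h5 : ga - 3 / 2 <> 0) by lra.
    assert (hxi : xi = (33 - 14 * ga) / 8) by (apply (Rmult_eq_reg_l (ga - 3 / 2)); nra).
    rewrite hxi in center.
    destruct (Rle_lt_dec ga (156 / 100)) as [h | h].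
    { apply center. left. nra. }
    destruct (Rle_lt_dec ga (158 / 100)) as [h' | h'].
    { exists (3 / 10), (7 / 10). split; [unfold Defs.Delta; lra | right].
      (* Near [ga = 1.564] both the center and the edge midpoint miss the bound. *)
      unfold p. rewrite patch_edge_sqnorm, hal, hb by lra. nra. }
    destruct (Rle_lt_dec ga 4) as [h'' | h''].
    + apply mid. right. nra.
    + apply center. left. nra.
Qed.

(** * Optimality by balancing the two deviations *)

Lemma edge_midpoint_radius_sq (g : R) :
  ((1 + 6 * g) * sqrt 3 / 12) ^ 2 = (1 + 6 * g) ^ 2 / 48.
Proof.
  replace (((1 + 6 * g) * sqrt 3 / 12) ^ 2)
    with ((1 + 6 * g) ^ 2 * (sqrt 3 * sqrt 3) / 144) by field.
  rewrite sqrt_sqrt by lra. field.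
Qed.

Lemma tetra_patch_vnorm (c g u v : R) :
  c ^ 2 = 8 / 9 -> 967 / 1000 <= g <= 969 / 1000 -> Defs.Delta u v ->
  (1 + 6 * g) * sqrt 3 / 12 <= vnorm (tetra_patch c g u v) <= (48 * g - 19) / 27.
Proof.
  intros hc hg [hu [hv huv]].
  assert (h3 : 0 < sqrt 3) by (apply sqrt_lt_R0; lra).
  assert (hn := vnorm_ge0 (tetra_patch c g u v)).
  assert (hN := tetra_patch_sqnorm c g u v (1 - u - v) hc eq_refl).
  destruct (simplex_qr u v (1 - u - v)) as [hq [hr [_ [hrq hsch]]]]; [lra .. |].
  assert (hle := sqnorm_poly_le g _ _ hg hq hr hrq).
  assert (hge := sqnorm_poly_ge g _ _ hg hq hr hsch).
  rewrite <- hN in hle, hge.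
  rewrite <- edge_midpoint_radius_sq in hge.
  split; apply Rsqr_incr_0; rewrite ?Rsqr_pow2; trivial; try lra.
  assert (0 <= (1 + 6 * g) * sqrt 3) by (apply Rmult_le_pos; lra). lra.
Qed.

Lemma admissible_vnorm_witness (c al be ga ze xi g : R) :
  c ^ 2 = 8 / 9 -> 9679 / 10000 <= g <= 9681 / 10000 ->
  G1_admissible c (patch c al be ga ze xi) ->
  exists u v, Defs.Delta u v /\
   ((48 * g - 19) / 27 <= vnorm (patch c al be ga ze xi u v) \/
    vnorm (patch c al be ga ze xi u v) <= (1 + 6 * g) * sqrt 3 / 12).
Proof.
  intros hc hg hadm.
  destruct (admissible_witness _ _ _ _ _ _ g hc hg hadm) as [u [v [hD h]]].
  exists u, v. split; [exact hD |].
  assert (h3 : 0 < sqrt 3) by (apply sqrt_lt_R0; lra).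
  assert (hn := vnorm_ge0 (patch c al be ga ze xi u v)).
  rewrite <- edge_midpoint_radius_sq in h.
  assert (0 <= (1 + 6 * g) * sqrt 3) by (apply Rmult_le_pos; lra).
  destruct h as [h | h]; [left | right]; apply Rsqr_incr_0;
    rewrite ?Rsqr_pow2; trivial; lra.
Qed.

(** The common deviation in [heq] separates the two errors: it bounds that of the balanced patch
    from above, and the witness point makes every admissible error at least as large. *)
Lemma d_s_optimal (c g : R) :
  c ^ 2 = 8 / 9 -> 9679 / 10000 <= g <= 9681 / 10000 ->
  ((48 * g - 19) / 27) ^ 2 - 1 = 1 - ((1 + 6 * g) * sqrt 3 / 12) ^ 2 ->
  forall al be ga ze xi, G1_admissible c (patch c al be ga ze xi) ->
  d_s (tetra_patch c g) <= d_s (patch c al be ga ze xi).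
Proof.
  intros hc hg heq al be ga ze xi hadm.
  set (s := (48 * g - 19) / 27) in *. set (m := (1 + 6 * g) * sqrt 3 / 12) in *.
  assert (h3 : 0 < sqrt 3) by (apply sqrt_lt_R0; lra).
  assert (hm : 0 <= m).
  { assert (0 <= (1 + 6 * g) * sqrt 3) by (apply Rmult_le_pos; lra). unfold m; lra. }
  assert (hs : 0 <= s) by (unfold s; lra).
  apply Rle_trans with (s ^ 2 - 1).
  - destruct (d_s_is_max c ((6 * g + 13) / 16) (9 * (2 * g - 1) / 16) g
      ((18 * g - 1) / 8) ((62 * g - 39) / 16)) as [[u [v [hD hmax]]] _].
    fold (tetra_patch c g) in hmax. rewrite hmax.
    assert (hb := tetra_patch_vnorm c g u v hc ltac:(lra) hD). fold s m in hb.
    assert (m ^ 2 <= vnorm (tetra_patch c g u v) ^ 2) by (apply pow_incr; lra).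
    assert (vnorm (tetra_patch c g u v) ^ 2 <= s ^ 2) by (apply pow_incr; lra).
    apply Rabs_le. lra.
  - destruct (admissible_vnorm_witness _ _ _ _ _ _ g hc hg hadm) as [u [v [hD hw]]].
    fold s m in hw.
    destruct (d_s_is_max c al be ga ze xi) as [_ hmax].
    apply Rle_trans with (2 := hmax u v hD).
    assert (hn := vnorm_ge0 (patch c al be ga ze xi u v)).
    destruct hw as [hw | hw].
    + apply Rle_trans with (2 := Rle_abs _).
      assert (h := pow_incr _ _ 2 (conj hs hw)). lra.
    + rewrite <- Rabs_Ropp. apply Rle_trans with (2 := Rle_abs _).
      assert (h := pow_incr _ _ 2 (conj hn hw)). lra.
Qed.

Lemma d_r_optimal (c g : R) :
  c ^ 2 = 8 / 9 -> 9679 / 10000 <= g <= 9681 / 10000 ->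
  (48 * g - 19) / 27 - 1 = 1 - (1 + 6 * g) * sqrt 3 / 12 ->
  forall al be ga ze xi, G1_admissible c (patch c al be ga ze xi) ->
  d_r (tetra_patch c g) <= d_r (patch c al be ga ze xi).
Proof.
  intros hc hg heq al be ga ze xi hadm.
  apply Rle_trans with ((48 * g - 19) / 27 - 1).
  - destruct (d_r_is_max c ((6 * g + 13) / 16) (9 * (2 * g - 1) / 16) g
      ((18 * g - 1) / 8) ((62 * g - 39) / 16)) as [[u [v [hD hmax]]] _].
    fold (tetra_patch c g) in hmax. rewrite hmax.
    assert (hb := tetra_patch_vnorm c g u v hc ltac:(lra) hD).
    apply Rabs_le. lra.
  - destruct (admissible_vnorm_witness _ _ _ _ _ _ g hc hg hadm) as [u [v [hD hw]]].
    destruct (d_r_is_max c al be ga ze xi) as [_ hmax].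
    apply Rle_trans with (2 := hmax u v hD).
    destruct hw as [hw | hw].
    + apply Rle_trans with (2 := Rle_abs _). lra.
    + rewrite <- Rabs_Ropp. apply Rle_trans with (2 := Rle_abs _). lra.
Qed.

Theorem mainTheorem5 (c : R) (hc : c = 2 * sqrt 2 / 3) :
  let gamma_s := (2189 + 108 * sqrt 2291) / 7602 in
  let gamma_r := (9587 - 2916 * sqrt 3) / 4686 in
  (G1_admissible c (family_patch c gamma_s) /\
   forall alpha beta gamma zeta xi : R,
     G1_admissible c (patch c alpha beta gamma zeta xi) ->
     d_s (family_patch c gamma_s) <= d_s (patch c alpha beta gamma zeta xi)) /\
  (G1_admissible c (family_patch c gamma_r) /\
   forall alpha beta gamma zeta xi : R,
     G1_admissible c (patch c alpha beta gamma zeta xi) ->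
     d_r (family_patch c gamma_r) <= d_r (patch c alpha beta gamma zeta xi)).
Proof.
  intros gamma_s gamma_r.
  assert (hc2 : c ^ 2 = 8 / 9).
  { rewrite hc. replace ((2 * sqrt 2 / 3) ^ 2) with (4 * (sqrt 2 * sqrt 2) / 9) by field.
    rewrite sqrt_sqrt; lra. }
  assert (h3 : sqrt 3 * sqrt 3 = 3) by (apply sqrt_sqrt; lra).
  assert (h2291 : sqrt 2291 * sqrt 2291 = 2291) by (apply sqrt_sqrt; lra).
  assert (p3 := sqrt_pos 3). assert (p2291 := sqrt_pos 2291).
  assert (b3 : 1732 / 1000 <= sqrt 3 <= 17321 / 10000) by nra.
  assert (b2291 : 47864 / 1000 <= sqrt 2291 <= 47865 / 1000) by nra.
  assert (hgs : 9679 / 10000 <= gamma_s <= 9681 / 10000) by (unfold gamma_s; lra).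
  assert (hgr : 9679 / 10000 <= gamma_r <= 9681 / 10000) by (unfold gamma_r; lra).
  rewrite !family_patch_tetra by trivial.
  split; split.
  - apply tetra_admissible; [trivial | lra].
  - apply d_s_optimal; trivial.
    (* The balance equation is [45612 g^2 - 26268 g - 17309 = 0], with [gamma_s] its positive
       root. *)
    rewrite edge_midpoint_radius_sq. unfold gamma_s. nra.
  - apply tetra_admissible; [trivial | lra].
  (* Here the balance is linear, [g (192 + 54 sqrt 3) = 292 - 9 sqrt 3]; rationalizing the
     denominator gives [gamma_r]. *)
  - apply d_r_optimal; trivial. unfold gamma_r. nra.
Qed.
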